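(* Let $n\ge 3$ and let $C_{\vec a}$ be the thick $n$-cycle with multiplicity vector $\vec a=(a_1,\dots,a_n)$ of positive integers. For $t=1,\dots,n-2$ let \[ g_t=\gcd\left(a_{i_1}\cdots a_{i_t}\;\middle|\; 1\le i_1<\cdots<i_t\le n\right). \] Then the sandpile group of $C_{\vec a}$ satisfies \[ \mathcal S(C_{\vec a})\cong \mathbb Z_{g_1}\oplus \mathbb Z_{g_2/g_1}\oplus\cdots\oplus \mathbb Z_{g_{n-2}/g_{n-3}}\oplus \mathbb Z_{|\mathcal S(C_{\vec a})|/g_{n-2}}, \] where $|\mathcal S(C_{\vec a})|=\sum_{i=1}^n \frac{a_1\cdots a_n}{a_i}$.
   Context: A thick $n$-cycle $C_{\vec a}$ with multiplicity vector $\vec a=(a_1,\dots,a_n)$ (positive integers) is the undirected multigraph on vertices $v_1,\dots,v_n$ in which $v_i$ and $v_{i+1}$ are joined by exactly $a_i$ parallel edges (indices modulo $n$), and there are no other edges. The Laplacian $L$ of an undirected multigraph on vertices $v_1,\dots,v_n$ has $L_{ii}=\deg(v_i)$ and $L_{ij}=-(\text{number of edges joining } v_i,v_j)$ for $i\ne j$. For a connected graph, the sandpile group $\mathcal S(G)$ is $\mathbb Z^{n-1}/\tilde\Delta\,\mathbb Z^{n-1}$, where $\tilde\Delta$ is the matrix obtained from $L$ by deleting the row and column of some vertex (the result is independent of the choice up to isomorphism). $\mathbb Z_m$ denotes the cyclic group of order $m$. *)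

(* Defs.v *)
From HB Require Import structures.
From mathcomp Require Import all_boot all_order all_algebra.
From mathcomp Require Import ring_quotient boolp.

Set Implicit Arguments.
Unset Strict Implicit.
Unset Printing Implicit Defensive.

Import Order.TTheory GRing.Theory Num.Theory.

Local Open Scope ring_scope.

(* [mult u v] is the number of parallel edges joining u and v. *)
Record multigraph (n : nat) := Multigraph {
  mult : 'I_n -> 'I_n -> nat;
  mult_sym : forall u v, mult u v = mult v u;
  mult_irr : forall v, mult v v = 0%N
}.

Definition degree n (G : multigraph n) (v : 'I_n) : nat :=
  (\sum_u mult G v u)%N.

Definition laplacian n (G : multigraph n) : 'M[int]_n :=
  \matrix_(i, j) if i == j then (degree G i)%:Z else - (mult G i j)%:Z.

Definition reduced_laplacian n (G : multigraph n) (s : 'I_n) : 'M[int]_n.-1 :=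
  row' s (col' s (laplacian G)).

Section Cokernel.
Variables (m n : nat) (M : 'M[int]_(m, n)).

Definition im_mx : {pred 'cV[int]_m} :=
  fun x => `[< exists y : 'cV[int]_n, x = M *m y >].

Fact im_mx_zmod_closed : zmod_closed im_mx.
Proof.
split=> [|x y /asboolP[u ->] /asboolP[v ->]]; apply/asboolP.
  by exists 0; rewrite mulmx0.
by exists (u - v); rewrite mulmxBr.
Qed.

HB.instance Definition _ :=
  GRing.isZmodClosed.Build 'cV[int]_m im_mx im_mx_zmod_closed.

Definition coker_mx : zmodType := Quotient.quot im_mx.

End Cokernel.

(* [s] is the deleted vertex; no connectedness is required to define this. *)
Definition sandpile_group n (G : multigraph n) (s : 'I_n) : zmodType :=
  coker_mx (reduced_laplacian G s).

Section ThickCycle.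
Variables (n : nat) (a : 'I_n -> nat).

(* [ordS i] is i + 1 mod n. For n >= 3 at most one of the two summands is
   nonzero, namely a i when j = i + 1 and a j when i = j + 1. *)
Definition thick_cycle_mult (i j : 'I_n) : nat :=
  if i == j then 0%N
  else ((if j == ordS i then a i else 0) + (if i == ordS j then a j else 0))%N.

Fact thick_cycle_mult_sym i j : thick_cycle_mult i j = thick_cycle_mult j i.
Proof. by rewrite /thick_cycle_mult eq_sym addnC. Qed.

Fact thick_cycle_mult_irr i : thick_cycle_mult i i = 0%N.
Proof. by rewrite /thick_cycle_mult eqxx. Qed.

Definition thick_cycle : multigraph n :=
  Multigraph thick_cycle_mult_sym thick_cycle_mult_irr.

Definition gcd_prods (t : nat) : nat :=
  \big[gcdn/0%N]_(A : {set 'I_n} | #|A| == t) (\prod_(i in A) a i)%N.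

Definition thick_cycle_order : nat :=
  (\sum_(i < n) (\prod_(j < n) a j) %/ a i)%N.

(* Orders of the n - 1 cyclic summands, indexed from 0. By [gcd_prods0] the one
   of index 0 is g_1; by [gcd_prods_dvd] and [gcd_prods_dvd_order] the
   quotients in nat are exact. *)
Definition thick_cycle_factor (k : nat) : nat :=
  if (k < n - 2)%N then (gcd_prods k.+1 %/ gcd_prods k)%N
  else (thick_cycle_order %/ gcd_prods (n - 2))%N.

Lemma gcd_prods0 : gcd_prods 0 = 1%N.
Proof.
rewrite /gcd_prods (big_pred1 set0) ?big_set0 // => A.
by rewrite /= cards_eq0.
Qed.

Lemma gcd_prods_dvd_prod t (A : {set 'I_n}) :
  (t <= #|A|)%N -> (gcd_prods t %| \prod_(i in A) a i)%N.
Proof.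
move=> tA; have: (0 < #|[set B : {set 'I_n} | B \subset A & #|B| == t]|)%N.
  by rewrite cards_draws bin_gt0.
case/card_gt0P=> B; rewrite inE => /andP[sBA tB].
apply: (@dvdn_trans (\prod_(i in B) a i)%N).
  by rewrite /gcd_prods (bigD1 B) //= dvdn_gcdl.
by rewrite [X in (_ %| X)%N](big_setID B) /= (setIidPr sBA) dvdn_mulr.
Qed.

Lemma gcd_prods_dvd t : (gcd_prods t %| gcd_prods t.+1)%N.
Proof.
apply: (big_ind (dvdn (gcd_prods t))) => // [x y dx dy|A /eqP cA].
  by rewrite dvdn_gcd dx.
by rewrite gcd_prods_dvd_prod ?cA.
Qed.

Lemma gcd_prods_dvd_order :
  (forall i, 0 < a i)%N -> (gcd_prods (n - 2) %| thick_cycle_order)%N.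
Proof.
move=> a0; apply: dvdn_sum => i _.
rewrite (bigD1 i) //= mulKn // (eq_bigl (mem [set~ i])) => [|j].
  by rewrite gcd_prods_dvd_prod // cardsC1 card_ord -subn1 leq_sub2l.
by rewrite !inE.
Qed.

End ThickCycle.

(* The cyclic group of order m, for m > 0. Unlike 'Z_m this is trivial for
   m = 1, which does occur among the summands. *)
Definition cyclic_group (m : nat) : zmodType := 'I_m.-1.+1.

Section DirectSum.
Variables (I : finType) (A : I -> zmodType).

Local Notation prodA := {dffun forall i, A i}.

Definition dffun_zero : prodA := [ffun i => 0].
Definition dffun_opp (f : prodA) : prodA := [ffun i => - f i].
Definition dffun_add (f g : prodA) : prodA := [ffun i => f i + g i].

Fact dffun_addA : associative dffun_add.
Proof. by move=> f g h; apply/ffunP=> i; rewrite !ffunE addrA. Qed.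

Fact dffun_addC : commutative dffun_add.
Proof. by move=> f g; apply/ffunP=> i; rewrite !ffunE addrC. Qed.

Fact dffun_add0 : left_id dffun_zero dffun_add.
Proof. by move=> f; apply/ffunP=> i; rewrite !ffunE add0r. Qed.

Fact dffun_addN : left_inverse dffun_zero dffun_opp dffun_add.
Proof. by move=> f; apply/ffunP=> i; rewrite !ffunE addNr. Qed.

HB.instance Definition _ := GRing.isZmodule.Build prodA
  dffun_addA dffun_addC dffun_add0 dffun_addN.

Definition direct_sum : zmodType := prodA.

End DirectSum.

Definition isomorphic (A B : zmodType) : Prop :=
  exists f : {additive A -> B}, bijective f.

Definition has_order (A : zmodType) (N : nat) : Prop :=
  exists f : A -> 'I_N, bijective f.

(* Main.v *)
(** Writing B for the incidence matrix of the cycle with the row of s removed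
    and D = diag(a), the reduced Laplacian is B D B^T. The Smith invariants of
    an integer matrix are read off from the gcds of its k x k minors. For
    k <= n - 2 this gcd is g_k: the minors of B D B^T lie in the ideal generated
    by those of D; conversely, for a k-set A of edges pick two edges p <> q
    outside A. Rows of sum zero factor through B (they are differences of a
    potential), in particular the rows e_i - e_p and e_i - e_q for i in A, and
    the matrices X, Y with these rows satisfy X D Y^T = diag(a_i, i in A). The
    determinant is obtained by bordering with the row w_i = (prod a) / a_i,
    since w D is constant and hence orthogonal to all rows of sum zero. *)

Require Import Defs.
From HB Require Import structures.
From mathcomp Require Import all_boot all_order all_algebra.
From mathcomp Require Import perm generic_quotient ring_quotient boolp ring.

Set Implicit Arguments.
Unset Strict Implicit.
Unset Printing Implicit Defensive.

Import Order.TTheory GRing.Theory Num.Theory.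

Local Open Scope ring_scope.

(** * Divisibility of minors, and the Smith form *)

(* The half of Cauchy-Binet needed to see that minors of a product lie in the
   ideal of minors of a factor. *)
Lemma det_mulmx_rowsub (R : comPzRingType) k m (A : 'M[R]_(k, m))
    (B : 'M[R]_(m, k)) :
  \det (A *m B) =
    \sum_(f : {ffun 'I_k -> 'I_m}) (\prod_i A i (f i)) * \det (rowsub f B).
Proof.
pose AB (s : 'S_k) i j := A i j * B j (s i).
transitivity (\sum_(f : {ffun 'I_k -> 'I_m}) \sum_(s : 'S_k)
    (-1) ^+ s * \prod_i AB s i (f i)).
  rewrite exchange_big; apply: eq_bigr => /= s _; rewrite -big_distrr /=.
  congr (_ * _); rewrite -(bigA_distr_bigA (AB s)) /=.
  by apply: eq_bigr => x _; rewrite mxE.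
apply: eq_bigr => f _; rewrite big_distrr /=; apply: eq_bigr => s _.
rewrite mulrCA big_split /=; congr (_ * (_ * _)).
by apply: eq_bigr => i _; rewrite mxE.
Qed.

(* [f] and [g] need not be injective: otherwise the minor vanishes. *)
Definition minors_dvd (e : int) k m n (M : 'M[int]_(m, n)) : Prop :=
  forall (f : 'I_k -> 'I_m) (g : 'I_k -> 'I_n), (e %| \det (mxsub f g M))%Z.

Lemma minors_dvd_tr e k m n (M : 'M[int]_(m, n)) :
  minors_dvd e k M -> minors_dvd e k M^T.
Proof. by move=> eM f g; rewrite -trmx_mxsub det_tr. Qed.

(** The expansion of a minor of the product runs over all row selections [h], not only increasing
    ones; this is why [minors_dvd] ranges over arbitrary maps. *)
Lemma minors_dvd_mull e k m n p (A : 'M[int]_(p, m)) (M : 'M[int]_(m, n)) :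
  minors_dvd e k M -> minors_dvd e k (A *m M).
Proof.
move=> eM f g; rewrite mxsub_mul det_mulmx_rowsub.
by apply: rpred_sum => h _; rewrite dvdz_mull // -mxsub_comp.
Qed.

Lemma minors_dvd_mulr e k m n p (A : 'M[int]_(n, p)) (M : 'M[int]_(m, n)) :
  minors_dvd e k M -> minors_dvd e k (M *m A).
Proof.
move=> eM; rewrite -[M *m A]trmxK; apply: minors_dvd_tr.
by rewrite trmx_mul; apply/minors_dvd_mull/minors_dvd_tr.
Qed.

Lemma minors_dvd_det e k m n (U : 'M[int]_(k, m)) (M : 'M[int]_(m, n))
    (V : 'M[int]_(n, k)) :
  minors_dvd e k M -> (e %| \det (U *m M *m V))%Z.
Proof.
move=> eM; have /(_ id id) := minors_dvd_mulr V (minors_dvd_mull U eM).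
by rewrite mxsub_id.
Qed.

Lemma minors_dvd_unit e k m n (L : 'M[int]_m) (M : 'M[int]_(m, n))
    (R : 'M[int]_n) : L \in unitmx -> R \in unitmx ->
  minors_dvd e k (L *m M *m R) <-> minors_dvd e k M.
Proof.
move=> Lu Ru; split=> eM; last exact/minors_dvd_mulr/minors_dvd_mull.
rewrite -[M](mulKmx Lu) -[L *m M](mulmxK Ru).
exact/minors_dvd_mull/minors_dvd_mulr.
Qed.

Lemma card_set_enum (T : finType) (A : {set T}) k : #|A| = k ->
  exists2 h : 'I_k -> T, injective h & A = [set h i | i : 'I_k].
Proof.
move=> <-; exists (@enum_val T (mem A)); first exact: enum_val_inj.
apply/setP=> x; apply/idP/imsetP=> [xA|[i _ ->]]; last exact: enum_valP.
by exists (enum_rank_in xA x); rewrite ?enum_rankK_in.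
Qed.

(** Principal minors give the products. Conversely, a selection of rows by an injective [f] factors
    as [diag_mx (d o f)] times a selection from the identity, so the minor is a multiple of the
    product over the image of [f]. *)
Lemma minors_dvd_diag e k n (d : 'rV[int]_n) :
  minors_dvd e k (diag_mx d) <->
  forall A : {set 'I_n}, #|A| = k -> (e %| \prod_(i in A) d 0 i)%Z.
Proof.
split=> [ed A /card_set_enum[h h_inj ->]|ed f g].
  rewrite big_imset /=; last exact: in2W.
  have -> : \prod_i d 0 (h i) = \det (mxsub h h (diag_mx d)).
    rewrite -[LHS](_ : \prod_i (\row_i d 0 (h i)) 0 i = _); last first.
      by apply: eq_bigr => i _; rewrite mxE.
    rewrite -det_diag; congr (\det _); apply/matrixP=> i j.
    by rewrite !mxE (inj_eq h_inj).
  exact: ed.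
have [f_inj|/injectivePn[i [j ij fij]]] := altP (injectiveP f); last first.
  by rewrite (determinant_alternate ij) ?dvdz0 // => l; rewrite !mxE fij.
have -> : mxsub f g (diag_mx d) =
    diag_mx (\row_i d 0 (f i)) *m mxsub f g 1%:M.
  apply/matrixP=> i j; rewrite mul_diag_mx !mxE.
  by rewrite mulr_natr.
rewrite det_mulmx det_diag dvdz_mulr //.
have := ed (f @: 'I_k); rewrite card_imset // card_ord => /(_ erefl).
rewrite big_imset /=; last exact: in2W.
by under [in X in _ -> X]eq_bigr do rewrite mxE.
Qed.

Lemma sorted_dvdz_nth (d : seq int) i j :
  sorted dvdz d -> (i <= j)%N -> (d`_i %| d`_j)%Z.
Proof.
move=> d_sorted ij; have [jd|jd] := ltnP j (size d); last first.
  by rewrite [d`_j]nth_default ?dvdz0.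
apply: (sorted_leq_nth _ _ _ d_sorted) => //; first exact: dvdz_trans.
  exact: dvdzz.
by rewrite inE (leq_ltn_trans ij).
Qed.

(** Induction removing the largest element [x] of [A]: since [A] lies in {0, ..., x}, one has #|A| -
    1 <= x, so the last factor on the left divides the entry at [x]. *)
Lemma sorted_dvdz_prod (d : seq int) m (A : {set 'I_m}) :
  sorted dvdz d -> (\prod_(i < #|A|) d`_i %| \prod_(i in A) d`_i)%Z.
Proof.
move=> d_sorted; have [k] := ubnP #|A|; elim: k => // k IH in A *.
have [->|/set0Pn[x0 x0A]] := eqVneq A set0.
  by rewrite cards0 big_ord0 dvd1z.
have [x xA x_max] : exists2 x, x \in A & forall y, y \in A -> (y <= x)%N.
  by case: (@arg_maxnP _ x0 (mem A) (@nat_of_ord m) x0A) => x; exists x.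
rewrite (cardsD1 x) xA /= add1n big_ord_recr /= (big_setD1 x xA) /= mulrC ltnS.
move=> Ak; apply: dvdz_mul; first exact: IH.
apply: sorted_dvdz_nth => //.
have cI : #|[set i : 'I_m | (i < x.+1)%N]| = x.+1.
  by rewrite -sum1dep_card (big_ord_narrow (ltn_ord x)) sum1_card card_ord.
have: (#|A| <= x.+1)%N.
  by rewrite -cI; apply/subset_leq_card/subsetP=> y yA; rewrite inE ltnS x_max.
by rewrite (cardsD1 x) xA.
Qed.

Lemma minors_dvd_smith e k m (d : seq int) : sorted dvdz d -> (k <= m)%N ->
  minors_dvd e k (diag_mx (\row_(i < m) d`_i)) <->
  (e %| \prod_(i < k) d`_i)%Z.
Proof.
move=> d_sorted km; rewrite minors_dvd_diag; split=> [ed|ed A cA].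
  have := ed [set widen_ord km i | i : 'I_k].
  have wi : injective (widen_ord km).
    by move=> i j /(congr1 val) ?; apply: val_inj.
  rewrite card_imset // card_ord => /(_ erefl).
  rewrite big_imset /=; last exact: in2W.
  by under eq_bigr do rewrite mxE.
under eq_bigr do rewrite mxE.
by apply: dvdz_trans (sorted_dvdz_prod A d_sorted); rewrite cA.
Qed.

(** * Cokernels of integer matrices *)

Section CokernelIsomorphism.
Variables (m n : nat) (M : 'M[int]_(m, n)) (B : zmodType).
Variable phi : {additive 'cV[int]_m -> B}.
Hypothesis phi_ker : forall x, phi x = 0 <-> exists y, x = M *m y.
Hypothesis phi_surj : forall b, exists x, phi x = b.

Local Notation coker := (Quotient.quot (@im_mx m n M)).

(** First isomorphism theorem: [phi] is applied to a chosen representative, and [phi_ker] makes the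
    choice irrelevant. *)
Definition coker_lift (x : coker_mx M) : B := phi (repr (x : coker)).

Lemma coker_lift_pi x : coker_lift (\pi_coker x)%qT = phi x.
Proof.
apply/eqP; rewrite -subr_eq0 -raddfB; apply/eqP/phi_ker.
have: repr (\pi_coker x)%qT - x \in @im_mx m n M.
  by rewrite Quotient.idealrBE reprK.
by move/asboolP.
Qed.

Fact coker_lift_zmod_morphism : zmod_morphism coker_lift.
Proof.
move=> x y; rewrite -[x](@reprK _ coker) -[y](@reprK _ coker).
by rewrite -raddfB !coker_lift_pi raddfB.
Qed.

HB.instance Definition _ :=
  GRing.isZmodMorphism.Build (coker_mx M) B coker_lift coker_lift_zmod_morphism.

Lemma coker_mx_isomorphic : isomorphic (coker_mx M) B.
Proof.
exists coker_lift.
have [g gK] := choice phi_surj.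
exists (fun b => (\pi_coker (g b))%qT) => [x|b]; last first.
  by rewrite /= coker_lift_pi.
rewrite -[RHS](@reprK _ coker); apply/eqP; rewrite -Quotient.idealrBE.
by apply/asboolP/phi_ker; rewrite raddfB gK subrr.
Qed.

End CokernelIsomorphism.

Lemma Zp1_mulrz_eq0 p (z : int) :
  ((Zp1 : 'I_p.+1) *~ z == 0) = (p.+1%:Z %| z)%Z.
Proof.
have nat0 k : ((Zp1 : 'I_p.+1) *+ k == 0) = (p.+1 %| k)%N.
  by rewrite Zp_mulrn -val_eqE /= modnMml mul1n.
by case: z => k; rewrite ?NegzE ?mulrNz ?oppr_eq0 dvdzE ?abszN -pmulrn nat0.
Qed.

Section SmithCokernel.
Variables (m : nat) (L R : 'M[int]_m) (d : 'rV[int]_m) (c : 'I_m -> nat).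
Hypotheses (L_unit : L \in unitmx) (R_unit : R \in unitmx).
Hypotheses (c_gt0 : forall i, (0 < c i)%N) (dc : forall i, absz (d 0 i) = c i).

Local Notation sumC := (direct_sum (fun i => cyclic_group (c i))).

(** [invmx L] carries the image of L D R onto that of D, as [R] is invertible; coordinates are then
    reduced modulo [c i], the absolute value of a possibly negative diagonal entry. *)
Definition smith_map (x : 'cV[int]_m) : sumC :=
  [ffun i => (Zp1 : 'I_(c i).-1.+1) *~ (invmx L *m x) i 0].

Fact smith_map_zmod_morphism : zmod_morphism smith_map.
Proof.
by move=> x y; apply/ffunP=> i; rewrite !ffunE mulmxBr !mxE mulrzBr.
Qed.

HB.instance Definition _ :=
  GRing.isZmodMorphism.Build 'cV[int]_m sumC smith_map smith_map_zmod_morphism.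

Lemma smith_map_ker x :
  smith_map x = 0 <-> exists y, x = L *m diag_mx d *m R *m y.
Proof.
have dvd_map i : (smith_map x i == 0) = (d 0%R i %| (invmx L *m x) i 0%R)%Z.
  by rewrite ffunE Zp1_mulrz_eq0 prednK // !dvdzE dc.
split=> [x0|[y xE]].
  have dx i : (d 0%R i %| (invmx L *m x) i 0%R)%Z by rewrite -dvd_map x0 ffunE.
  exists (invmx R *m \col_i divz ((invmx L *m x) i 0) (d 0 i)).
  rewrite mulmxA mulmxK // -mulmxA; rewrite -[LHS](mulKVmx L_unit).
  congr (_ *m _); apply/matrixP=> i j; rewrite ord1 mul_diag_mx [RHS]mxE.
  by rewrite [in RHS]mxE mulrC divzK.
apply/ffunP=> i; apply/eqP; rewrite [X in _ == X]ffunE dvd_map xE.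
by rewrite -!mulmxA mulKmx // mul_diag_mx mxE dvdz_mulr.
Qed.

Lemma smith_map_surj b : exists x, smith_map x = b.
Proof.
exists (L *m \col_i (val (b i : 'I_(c i).-1.+1))%:Z); apply/ffunP=> i.
rewrite ffunE mulKmx // mxE -pmulrn Zp_mulrn; apply: val_inj => /=.
by rewrite modnMml mul1n modn_small.
Qed.

Lemma coker_mx_smith : isomorphic (coker_mx (L *m diag_mx d *m R)) sumC.
Proof. exact: coker_mx_isomorphic smith_map_ker smith_map_surj. Qed.

End SmithCokernel.

Lemma isomorphic_direct_sum_order m (A : zmodType) (c : 'I_m -> nat) :
  (forall i, (0 < c i)%N) ->
  isomorphic A (direct_sum (fun i => cyclic_group (c i))) ->
  has_order A (\prod_i c i)%N.
Proof.
move=> c_gt0 [f f_bij].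
pose T := {dffun forall i : 'I_m, 'I_(c i).-1.+1}.
have cT : #|{: T}| = (\prod_i c i)%N.
  rewrite card_dep_ffun foldrE big_image /=; apply: eq_bigr => i _.
  by rewrite card_ord prednK.
pose r (t : direct_sum (fun i => cyclic_group (c i))) : 'I_(\prod_i c i)%N :=
  cast_ord cT (enum_rank (t : T)).
have r_bij : bijective r.
  exists (fun k => enum_val (cast_ord (esym cT) k) : T) => [t|k].
    by rewrite /r cast_ordK enum_rankK.
  by rewrite /r enum_valK cast_ordKV.
by exists (r \o f); apply: bij_comp.
Qed.

(** * Factorization of the Laplacian through the incidence matrix *)

Lemma sumr_delta (V : zmodType) n (x : 'I_n) (F : 'I_n -> V) :
  \sum_e F e *+ (e == x) = F x.
Proof.
by rewrite (bigD1 x) //= eqxx big1 ?addr0 // => e /negPf->.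
Qed.

Definition cycle_incidence n : 'M[int]_n :=
  \matrix_(v, e) ((v == e)%:R - (v == ordS e)%:R).

Definition edge_weights n (a : 'I_n -> nat) : 'rV[int]_n := \row_e (a e)%:Z.

Lemma cycle_incidence_col_sum n (e : 'I_n) : \sum_v cycle_incidence n v e = 0.
Proof.
under eq_bigr do rewrite mxE; rewrite sumrB.
by rewrite !(sumr_delta _ (fun=> 1)) subrr.
Qed.

Lemma mulmx_diag_trE (R : comPzRingType) k l n (A : 'M[R]_(k, n)) (d : 'rV_n)
    (B : 'M[R]_(l, n)) i j :
  (A *m diag_mx d *m B^T) i j = \sum_e A i e * d 0 e * B j e.
Proof. by rewrite mxE; apply: eq_bigr => e _; rewrite mul_mx_diag !mxE. Qed.

Lemma laplacian_row_sum n (G : multigraph n) i : \sum_j laplacian G i j = 0.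
Proof.
rewrite (bigD1 i) //= mxE eqxx /degree (bigD1 i) //= mult_irr add0n.
rewrite (big_morph Posz PoszD erefl) -big_split big1 //= => j ji.
by rewrite mxE eq_sym (negPf ji) subrr.
Qed.

(* Both sides have zero row sums, so only off-diagonal entries matter. *)
Lemma laplacian_thick_cycle n (a : 'I_n -> nat) :
  laplacian (thick_cycle a) =
  cycle_incidence n *m diag_mx (edge_weights a) *m (cycle_incidence n)^T.
Proof.
set M := RHS.
have off i j : i != j -> laplacian (thick_cycle a) i j = M i j.
  move=> ij; rewrite mulmx_diag_trE mxE (negPf ij) /= /thick_cycle_mult.
  rewrite (negPf ij).
  (* An edge contributes only when its two ends are [i] and [j], in one order or the other. *)
  transitivity (\sum_e - ((a e * (j == ordS e))%:Z *+ (e == i) +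
                          (a e * (i == ordS e))%:Z *+ (e == j))).
    rewrite sumrN big_split /= !sumr_delta -PoszD; congr (- (_ + _)%:Z);
    by case: ifP; rewrite ?muln1 ?muln0.
  apply: eq_bigr => e _; rewrite !mxE ![_ == e]eq_sym.
  have distinct x : (x == i) && (x == j) = false.
    by apply: contraNF ij => /andP[/eqP<- /eqP<-].
  move: (distinct e) (distinct (ordS e)); rewrite ![ordS e == _]eq_sym.
  case: (e == i); case: (e == j); case: (i == _); case: (j == _) => //= _ _;
    by rewrite ?muln0 ?muln1; ring.
have sumM i : \sum_j M i j = 0.
  under eq_bigr do rewrite mulmx_diag_trE; rewrite exchange_big big1 //= => e _.
  by rewrite -mulr_sumr cycle_incidence_col_sum mulr0.
apply/matrixP=> i j; have [<-|/off//] := eqVneq i j.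
move: (laplacian_row_sum (thick_cycle a) i) (sumM i).
rewrite (bigD1 i) //= [X in _ -> X = 0 -> _](bigD1 i) //=.
rewrite (eq_bigr (M i)) => [|k ki]; last by rewrite off // eq_sym.
by move=> /eqP + /eqP; rewrite !addr_eq0 => /eqP -> /eqP ->.
Qed.

Lemma thick_cycle_order_gt0 n (a : 'I_n -> nat) :
  (0 < n)%N -> (forall i, 0 < a i)%N -> (0 < thick_cycle_order a)%N.
Proof.
case: n a => // n a _ a_gt0.
rewrite /thick_cycle_order big_ord_recl ltn_addr // divn_gt0 //.
by rewrite dvdn_leq ?prodn_gt0 // (bigD1 ord0) //= dvdn_mulr.
Qed.

(** * Minors and determinant of the reduced Laplacian *)

Section ThickCycle.
Variables (m : nat) (a : 'I_m.+1 -> nat) (s : 'I_m.+1).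

Local Notation n := m.+1.
Local Notation B := (row' s (cycle_incidence n)).
Local Notation D := (diag_mx (edge_weights a)).

Lemma reduced_laplacian_thick_cycle :
  reduced_laplacian (thick_cycle a) s = B *m D *m B^T.
Proof.
rewrite /reduced_laplacian laplacian_thick_cycle.
apply/matrixP=> i j; rewrite mulmx_diag_trE [LHS]mxE [LHS]mxE mulmx_diag_trE.
by apply: eq_bigr => e _; rewrite ![row' _ _ _ _]mxE.
Qed.

(* The entries of U are potentials: partial sums of the rows of X along the
   cycle, normalised to vanish at s. *)
Lemma zero_sum_incidence k (X : 'M[int]_(k, n)) :
  (forall i, \sum_j X i j = 0) -> exists U : 'M[int]_(k, m), X = U *m B.
Proof.
move=> X0; pose Z i (l : nat) := \sum_(j < n | (j < l)%N) X i j.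
have Z0 i : Z i 0 = 0 by rewrite /Z big_pred0.
have Zn i : Z i n = 0.
  by rewrite -(X0 i); apply: eq_bigl => j; rewrite ltn_ord.
have ZS i (e : 'I_n) : Z i e.+1 = Z i e + X i e.
  rewrite /Z (bigD1 e) //= addrC; congr (_ + _); apply: eq_bigl => j.
  by rewrite ltnS andbC -val_eqE -ltn_neqAle.
(* At the last edge the index wraps to 0, where the potential agrees with its value at [n] because
   the row sums to zero. *)
have ZordS i (e : 'I_n) : Z i (ordS e) = Z i e + X i e.
  rewrite -ZS /=; have [lt_en|] := ltnP e.+1 n; first by rewrite modn_small.
  by move=> ne; have /eqP-> : e.+1 == n;
    rewrite ?eqn_leq ?ne ?ltn_ord ?modnn ?Z0 ?Zn.
exists (\matrix_(i, v) (Z i s - Z i (lift s v))); apply/matrixP=> i e.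
(* The term at [s] vanishes, so the deleted row of the incidence matrix can be restored; the
   constant [Z i s] then drops out because columns sum to zero. *)
transitivity (\sum_(v < n) (Z i s - Z i v) * cycle_incidence n v e); last first.
  rewrite (bigD1_ord s) //= subrr mul0r add0r [RHS]mxE.
  by apply: eq_bigr => v _; rewrite !mxE.
under eq_bigr do rewrite mulrBl; rewrite sumrB -mulr_sumr.
rewrite cycle_incidence_col_sum mulr0 sub0r.
under eq_bigr do rewrite mxE mulrBr !mulr_natr.
by rewrite sumrB !sumr_delta ZordS opprB addrC addKr.
Qed.

Lemma dvdz_gcd_prods (e : int) t :
  (e %| (gcd_prods a t)%:Z)%Z <->
  forall A : {set 'I_n}, #|A| = t -> (e %| \prod_(i in A) edge_weights a 0 i)%Z.
Proof.
have prodE (A : {set 'I_n}) :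
    \prod_(i in A) edge_weights a 0 i = (\prod_(i in A) a i)%N%:Z.
  by rewrite (big_morph Posz PoszM erefl); apply: eq_bigr => i _; rewrite mxE.
rewrite dvdzE; split=> [/dvdn_biggcdP eg A /eqP cA|eA].
  by rewrite prodE dvdzE eg.
by apply/dvdn_biggcdP=> A /eqP /eA; rewrite prodE dvdzE.
Qed.

Lemma minors_dvd_thick_cycle (e : int) k : (k < m)%N ->
  minors_dvd e k (reduced_laplacian (thick_cycle a) s) <->
  (e %| (gcd_prods a k)%:Z)%Z.
Proof.
move=> km; rewrite reduced_laplacian_thick_cycle dvdz_gcd_prods.
split=> [eM A cA|/minors_dvd_diag eD]; last first.
  exact/minors_dvd_mulr/minors_dvd_mull.
(* The complement of [A] has m + 1 - k elements, at least two since k < m. *)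
have /card_gt1P[p [q [pA qA pq]]] : (1 < #|~: A|)%N.
  by rewrite cardsCs setCK card_ord cA ltn_subRL addn1.
have [h h_inj AE] := card_set_enum cA.
have out x i : x \in ~: A -> (x == h i) = false.
  by apply: contraTF => /eqP->; rewrite inE negbK AE imset_f.
pose X x : 'M[int]_(k, n) := \matrix_(i, j) ((j == h i)%:R - (j == x)%:R).
have X0 x i : \sum_j X x i j = 0.
  under eq_bigr do rewrite mxE.
  by rewrite sumrB !(sumr_delta _ (fun=> 1)) subrr.
have [U UE] := zero_sum_incidence (X0 p).
have [V VE] := zero_sum_incidence (X0 q).
have := minors_dvd_det U V^T eM.
have -> : U *m (B *m D *m B^T) *m V^T = X p *m D *m (X q)^T.
  by rewrite UE VE trmx_mul !mulmxA.
have -> : X p *m D *m (X q)^T = diag_mx (\row_i edge_weights a 0 (h i)).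
  apply/matrixP=> i j; rewrite mulmx_diag_trE.
  transitivity (\sum_e (edge_weights a 0 e *+ (i == j)) *+ (e == h i)).
    apply: eq_bigr => x _; rewrite ![X _ _ _]mxE.
    (* Column [p] is zero in [X q] and column [q] is zero in [X p], so only columns in [A] survive
       in the product. *)
    have [->|xp] := eqVneq x p.
      rewrite !out // (negPf pq) /=; ring.
    have [->|xq] := eqVneq x q.
      rewrite !out // /=; ring.
    rewrite !subr0; have [->|xi] := eqVneq x (h i); last by rewrite !mul0r.
    by rewrite mul1r mulr_natr (inj_eq h_inj).
  by rewrite sumr_delta !mxE.
rewrite det_diag AE big_imset /=; last exact: in2W.
by under eq_bigr do rewrite mxE.
Qed.

Lemma absz_det_thick_cycle : (forall i, 0 < a i)%N ->
  absz (\det (reduced_laplacian (thick_cycle a) s)) = thick_cycle_order a.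
Proof.
move=> a_gt0; rewrite reduced_laplacian_thick_cycle.
pose P := (\prod_i a i)%N; pose N := thick_cycle_order a.
have P_gt0 : (0 < P)%N by rewrite prodn_gt0.
have w_dvd i : (a i %| P)%N by rewrite /P (bigD1 i) //= dvdn_mulr.
have N_gt0 : (0 < N)%N by rewrite thick_cycle_order_gt0.
pose w : 'M[int]_(1, 1 + m) := \row_i (P %/ a i)%N%:Z.
(* The rows e_i - e_0 for i > 0, a basis of the integer vectors of sum zero. *)
pose X : 'M[int]_(m, 1 + m) := row_mx (const_mx (-1)) 1%:M.
have X1 : X *m const_mx 1 = 0 :> 'M_(m, 1).
  rewrite -(@col_mx_const _ 1 m) mul_row_col mul1mx; apply/matrixP=> i j.
  by rewrite !mxE big_ord1 !mxE mulr1 addNr.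
have X0 i : \sum_j X i j = 0.
  move/matrixP/(_ i 0): X1; rewrite !mxE => X1i; rewrite -[RHS]X1i.
  by apply: eq_bigr => j _; rewrite [const_mx _ _ _]mxE mulr1.
have w1 : w *m const_mx 1 = N%:Z%:M.
  apply/matrixP=> i j; rewrite !ord1 !mxE eqxx mulr1n.
  rewrite /N /thick_cycle_order (big_morph Posz PoszD erefl).
  by apply: eq_bigr => k _; rewrite !mxE mulr1.
have wD : w *m D = const_mx P%:Z.
  by apply/matrixP=> i j; rewrite mul_mx_diag !mxE -PoszM divnK.
have [U UE] := zero_sum_incidence X0.
(* Stacking e_0 on top of X = U B gives a unitriangular square matrix with det U as a factor of its
   determinant. *)
have detU : absz (\det U) = 1%N.
  pose e0 : 'M[int]_(1, 1 + m) := row_mx 1 0.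
  have: \det (block_mx 1 0 0 U *m (col_mx e0 B : 'M_(1 + m))) = 1.
    have -> : block_mx 1 0 0 U *m col_mx e0 B = block_mx 1 0 (const_mx (-1)) 1.
      by rewrite mul_block_col !mul1mx !mul0mx add0r addr0 -UE.
    by rewrite det_lblock !det1 mulr1.
  rewrite det_mulmx det_ublock det1 mul1r => /(congr1 absz).
  by rewrite abszM => /eqP; rewrite muln_eq1 => /andP[/eqP].
have detW : \det (col_mx w X : 'M_(1 + m)) = N%:Z.
  (* Multiplying by [Q] adds all other columns to the first one, which becomes (N, 0, ..., 0). *)
  pose Q : 'M[int]_(1 + m) := row_mx (const_mx 1) (col_mx 0 1%:M).
  have detQ : \det Q = 1.
    rewrite /Q -(@col_mx_const _ 1 m) -block_mxEh det_lblock det1 mulr1.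
    by rewrite det_mx11 mxE.
  have : \det (col_mx w X *m Q) = N%:Z.
    rewrite mul_col_row w1 X1 det_ublock det_scalar expr1 mul_row_col mulmx0.
    by rewrite mulmx1 add0r det1 mulr1.
  by rewrite det_mulmx detQ mulr1.
have detX : \det (X *m D *m X^T) = N%:Z.
  (* For W = [col_mx w X], the matrix W D W^T is block triangular because X D w^T = 0. Its
     determinant is also N P N, and cancelling P N leaves N. *)
  have: \det (col_mx w X *m D *m (col_mx w X)^T) =
      P%:Z * N%:Z * \det (X *m D *m X^T).
    rewrite mul_col_mx tr_col_mx mul_col_row.
    have -> : X *m D *m w^T = 0.
      rewrite -mulmxA -[D]tr_diag_mx -trmx_mul wD.
      have -> : (const_mx P%:Z)^T = const_mx 1 *m P%:Z%:M :> 'cV[int]_(1 + m).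
        by apply/matrixP=> i j; rewrite mul_mx_scalar !mxE mulr1.
      by rewrite mulmxA X1 mul0mx.
    have -> : w *m D *m w^T = (P%:Z * N%:Z)%:M.
      have -> : w *m D = P%:Z *: (const_mx 1)^T.
        by apply/matrixP=> i j; rewrite wD !mxE mulr1.
      by rewrite -scalemxAl -trmx_mul w1 tr_scalar_mx scale_scalar_mx.
    by rewrite det_ublock det_scalar expr1.
  have detD : \det D = P%:Z.
    rewrite det_diag (big_morph Posz PoszM erefl).
    by apply: eq_bigr => i _; rewrite mxE.
  rewrite [LHS]det_mulmx [X in X * _]det_mulmx det_tr detW detD.
  have PN : P%:Z * N%:Z != 0 by rewrite mulf_neq0 // -lt0n.
  by move=> E; apply: (mulfI PN); rewrite -E; ring.
have XE : X *m D *m X^T = U *m (B *m D *m B^T) *m U^T.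
  by rewrite UE trmx_mul !mulmxA.
have := congr1 absz detX; rewrite XE !(det_mulmx U, det_mulmx _ U^T).
by rewrite det_tr !abszM detU mul1n muln1.
Qed.

End ThickCycle.

Theorem theorem1 (n : nat) (n_ge3 : (3 <= n)%N)
    (a : 'I_n -> nat) (a_gt0 : forall i, (0 < a i)%N) (s : 'I_n) :
  has_order (sandpile_group (thick_cycle a) s) (thick_cycle_order a) /\
  isomorphic (sandpile_group (thick_cycle a) s)
    (direct_sum (fun k : 'I_n.-1 => cyclic_group (thick_cycle_factor a k))).
Proof.
case: n n_ge3 a a_gt0 s => // m m_ge2 a a_gt0 s; rewrite /sandpile_group.
set M := reduced_laplacian _ _.
have [L Lu [R Ru [d d_sorted ME]]] := int_Smith_normal_form M.
(* If [d] is shorter than [m], its missing entries read as 0; the positive product [NE] excludes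
   this. *)
have {}ME : M = L *m diag_mx (\row_(i < m) d`_i) *m R.
  rewrite {1}ME; congr (_ *m _ *m _); apply/matrixP=> i j; rewrite !mxE.
  by rewrite val_eqE.
have absM k (F : 'I_k -> int) : absz (\prod_i F i) = (\prod_i absz (F i))%N.
  exact: (big_morph absz abszM erefl).
have gE k : (k < m)%N -> (\prod_(i < k) absz (d`_i)%R)%N = gcd_prods a k.
  move=> km; rewrite -absM.
  (* Both sides say that [e] divides all k x k minors of [M]. Having the same divisors, the two
     numbers agree up to sign. *)
  have eqv e : (e %| \prod_(i < k) d`_i)%Z <-> (e %| (gcd_prods a k)%:Z)%Z.
    rewrite -(minors_dvd_smith e d_sorted (ltnW km)).
    rewrite -(minors_dvd_unit _ _ _ Lu Ru) -ME.
    exact: minors_dvd_thick_cycle.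
  apply/eqP; rewrite eqn_dvd.
  have /eqv := dvdzz (\prod_(i < k) d`_i).
  have /eqv := dvdzz (gcd_prods a k)%:Z.
  by rewrite !dvdzE /= => -> ->.
have NE : (\prod_(i < m) absz (d`_i)%R)%N = thick_cycle_order a.
  rewrite -absM -(absz_det_thick_cycle s a_gt0) -/M ME !det_mulmx !abszM.
  have unit1 (V : 'M[int]_m) : V \in unitmx -> absz (\det V) = 1%N.
    by rewrite unitmxE => /orP[] /eqP->.
  rewrite (unit1 L) // (unit1 R) // mul1n muln1 det_diag.
  by congr absz; apply: eq_bigr => i _; rewrite mxE.
have g_gt0 k : (k < m)%N -> (0 < gcd_prods a k)%N.
  move=> km; have: (gcd_prods a k %| \prod_(i in [set: 'I_m.+1]) a i)%N.
    by rewrite gcd_prods_dvd_prod // cardsT card_ord ltnW // ltnS ltnW.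
  by apply: dvdn_gt0; rewrite prodn_gt0.
(* Each Smith entry is a quotient of consecutive prefix products. These are given by [gE], except
   that the full product, reached at k = m - 1, is given by [NE]. *)
have factorE (k : 'I_m) : absz d`_k = thick_cycle_factor a k.
  rewrite /thick_cycle_factor subSS subn1; have km := ltn_ord k.
  case: ltnP => [k1m|mk].
    rewrite -!gE // ?big_ord_recr ?mulKn ?gE ?g_gt0 //=.
    by rewrite -ltn_predRL.
  have m_gt0 : (0 < m)%N by apply: leq_trans km.
  have kE : m.-1 = k by apply/eqP; rewrite eqn_leq mk -ltnS prednK.
  have <- : (\prod_(i < k.+1) absz (d`_i)%R)%N = thick_cycle_order a.
    by rewrite -NE -kE prednK.
  by rewrite kE -gE // big_ord_recr mulKn //= gE // g_gt0.
(* Positivity matters: [cyclic_group 0] is trivial, not infinite cyclic. *)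
have factor_gt0 (k : 'I_m) : (0 < thick_cycle_factor a k)%N.
  have: (0 < thick_cycle_order a)%N.
    by rewrite thick_cycle_order_gt0.
  by rewrite -NE (bigD1 k) //= factorE muln_gt0 => /andP[].
have iso : isomorphic (coker_mx M)
    (direct_sum (fun k : 'I_m => cyclic_group (thick_cycle_factor a k))).
  rewrite ME; apply: coker_mx_smith => // k.
  by rewrite mxE factorE.
split=> //.
have := isomorphic_direct_sum_order factor_gt0 iso.
rewrite (_ : (\prod_i _)%N = thick_cycle_order a) // -NE.
by apply: eq_bigr => k _; rewrite factorE.
Qed.
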